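(* Let $d\geq 2$ be an integer, let $\mathcal{A}\subset\mathbb{R}^{d+1}$ be the set of squared facet volume vectors of acute $d$-dimensional simplices in $\mathbb{R}^d$, let $P_d:=\operatorname{conv}\big(\tfrac{2d+2}{d-1}\Delta_d \cup (d+1)(-\Delta_d)\big)\subseteq W_{d+1}$, and let $P_d^*$ be its polar in $W_{d+1}$. Then \[ \mathcal{A} \cap H_{d+1} = \operatorname{relint} (P_d^* ) + \tfrac1{d+1}e . \]
   Context: Let $\operatorname{VOL}_{d,d+1}$ be the set of all vectors $(\operatorname{vol}_{d-1}(F_1),\dots,\operatorname{vol}_{d-1}(F_{d+1}))$, where $(x_1,\dots,x_{d+1})$ ranges over all $(d+1)$-tuples of affinely independent points in $\mathbb{R}^d$ and $F_i=\operatorname{conv}(\{x_1,\dots,x_{d+1}\}\setminus\{x_i\})$ is the facet opposite to $x_i$. A simplex with facet volumes $\alpha_1,\dots,\alpha_{d+1}$ is called acute (in this convention) if $\alpha_i^2<\sum_{j\neq i}\alpha_j^2$ for all $1\leq i\leq d+1$. Thus \[ \mathcal{A}=\big\{(\alpha_1^2,\dots,\alpha_{d+1}^2) : (\alpha_1,\dots,\alpha_{d+1})\in\operatorname{VOL}_{d,d+1},\ \alpha_i^2<\textstyle\sum_{j\neq i}\alpha_j^2\text{ for all }1\leq i\leq d+1\big\}. \] Let $e_1,\dots,e_{d+1}$ be the standard basis of $\mathbb{R}^{d+1}$ and $e:=\sum_{i=1}^{d+1}e_i$. $W_{d+1}:=\{\lambda\in\mathbb{R}^{d+1}:\sum_i\lambda_i=0\}$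 and $H_{d+1}:=\{s\in\mathbb{R}^{d+1}:\sum_i s_i=1\}$. $\Delta_d:=\operatorname{conv}\{e_1-\tfrac1{d+1}e,\dots,e_{d+1}-\tfrac1{d+1}e\}\subseteq W_{d+1}$. With $\langle\cdot,\cdot\rangle$ the standard scalar product, the polar of a set $P\subseteq W_{d+1}$ in $W_{d+1}$ is $P^*:=\{y\in W_{d+1}:\langle x,y\rangle\leq 1\text{ for all }x\in P\}$. $\operatorname{relint}$ denotes relative interior. *)

(* Defs.v *)
From HB Require Import structures.
From mathcomp Require Import all_boot all_order all_algebra.
From mathcomp Require Import all_classical all_reals all_analysis.

Set Implicit Arguments.
Unset Strict Implicit.
Unset Printing Implicit Defensive.

Import Order.TTheory GRing.Theory Num.Theory.
Import numFieldNormedType.Exports.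

Local Open Scope classical_set_scope.
Local Open Scope ring_scope.

Section convexity.
Context {R : realType} {n : nat}.
Implicit Types A P : set 'rV[R]_n.

Definition conv_hull A : set 'rV[R]_n :=
  smallest (@convex_set R 'rV[R]_n) A.

Definition affine_set A :=
  forall x y (t : R), A x -> A y -> A (t *: x + (1 - t) *: y).

Definition affine_hull A : set 'rV[R]_n := smallest affine_set A.

(* Interior of A in the subspace topology of its affine hull. *)
Definition relint A : set 'rV[R]_n :=
  [set x | affine_hull A x /\ within (affine_hull A) (nbhs x) A].

Definition affinely_independent (I : finType) (x : I -> 'rV[R]_n) :=
  forall c : I -> R, \sum_i c i = 0 -> \sum_i c i *: x i = 0 ->
    forall i, c i = 0.

Definition dot (x y : 'rV[R]_n) : R := \sum_i x 0 i * y 0 i.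

Definition std_basis (i : 'I_n) : 'rV[R]_n := delta_mx 0 i.

Definition ones : 'rV[R]_n := \sum_i std_basis i.

Definition sum0_space : set 'rV[R]_n := [set y | \sum_i y 0 i = 0].

Definition sum1_plane : set 'rV[R]_n := [set s | \sum_i s 0 i = 1].

Definition polar_sum0 P : set 'rV[R]_n :=
  [set y | sum0_space y /\ forall x, P x -> dot x y <= 1].

End convexity.
Arguments ones {R n}.

Section volume.
Context {R : realType}.

(* k-fold product of the one-dimensional Lebesgue measure, transported along
   the identification of R * R^k with R^(k+1). *)
Fixpoint lebesgue_tuple {k : nat} :
    set (k.-tuple (measurableTypeR R)) -> \bar R :=
  match k with
  | 0 => \d_([tuple] : 0.-tuple (measurableTypeR R))
  | k'.+1 => pushforward (lebesgue_measure \x lebesgue_tuple (k := k'))%E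
      (fun p : measurableTypeR R * k'.-tuple (measurableTypeR R) =>
         [tuple of p.1 :: p.2])
  end.

(* The embedding y |-> a + y U of R^k is isometric when the rows of U are
   orthonormal.  The measure obtained in such coordinates does not depend on
   the choice of (a, U), because Lebesgue measure on R^k is invariant under
   isometries. *)
Definition has_volume (n k : nat) (S : set 'rV[R]_n) (v : R) :=
  exists (a : 'rV[R]_n) (U : 'M[R]_(k, n)),
    [/\ U *m U^T = 1%:M,
        S `<=` range (fun y : 'rV[R]_k => a + y *m U) &
        lebesgue_tuple
          [set t : k.-tuple (measurableTypeR R) |
             S (a + (\row_i tnth t i) *m U)] = v%:E].

Context {d : nat}.

Definition facet (x : 'I_d.+1 -> 'rV[R]_d) (i : 'I_d.+1) : set 'rV[R]_d :=
  conv_hull [set x j | j in [set j | j != i]].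

Definition VOL : set 'rV[R]_d.+1 :=
  [set alpha | exists x : 'I_d.+1 -> 'rV[R]_d,
     affinely_independent x /\
     forall i, has_volume d.-1 (facet x i) (alpha 0 i)].

(* A condition on facet volumes, not the usual one on dihedral angles. *)
Definition acute (alpha : 'rV[R]_d.+1) :=
  forall i, alpha 0 i ^+ 2 < \sum_(j | j != i) alpha 0 j ^+ 2.

Definition acute_squared_volumes : set 'rV[R]_d.+1 :=
  [set \row_i (alpha 0 i ^+ 2) | alpha in VOL `&` acute].

Definition Delta : set 'rV[R]_d.+1 :=
  conv_hull (range (fun i => std_basis i - (d.+1%:R)^-1 *: ones)).

Definition P_polytope : set 'rV[R]_d.+1 :=
  conv_hull
    ([set ((2 * d%:R + 2) / (d%:R - 1)) *: x | x in Delta] `|`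
     [set d.+1%:R *: x | x in [set - y | y in Delta]]).

End volume.
Arguments VOL : clear implicits.
Arguments acute_squared_volumes : clear implicits.
Arguments Delta : clear implicits.
Arguments P_polytope : clear implicits.

(* Main.v *)
(** Both sides turn out to be the set of [s] with [\sum_i s_i = 1] and
    [0 < s_i < 1/2] for all [i]; for the right-hand side this is a computation
    with the vertices of the polytope.  For the left-hand side one has to build a
    simplex with prescribed squared facet volumes [s].  The conditions on [s] say
    that [s] is the degree vector of a complete graph with positive edge weights,
    so [s] is the diagonal of its weighted Laplacian, which is positive
    semidefinite with kernel spanned by the all-ones vector.  It is therefore the
    Gram matrix of vectors [n_0, ..., n_d] spanning [R^d] with sum [0] and
    [|n_i|^2 = s_i].  The simplex with facet normals [n_i] is dual to this
    configuration, and Jacobi's identity for complementary minors shows that its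
    facet volumes are proportional to the [|n_i|]; it remains to rescale. *)

Require Import Defs.
From mathcomp Require Import all_boot all_order all_algebra.
From mathcomp Require Import all_classical all_reals all_analysis.
From mathcomp Require Import ring lra.

Set Implicit Arguments.
Unset Strict Implicit.
Unset Printing Implicit Defensive.

Import Order.TTheory GRing.Theory Num.Theory.
Import numFieldNormedType.Exports.

Local Open Scope classical_set_scope.
Local Open Scope ring_scope.

(** * Real linear algebra *)

Section linear_algebra.
Context {R : realType}.

(** Upper rather than lower triangular: for row vectors the first coordinate of [y *m U] then
    depends only on the first coordinate of [y], which lets a simplex be sliced along its first
    axis. *)
Definition upper_posdiag k (U : 'M[R]_k) :=
  (forall i j : 'I_k, (j < i)%N -> U i j = 0) /\ (forall i, 0 < U i i).

Lemma det_upper_posdiag k (U : 'M[R]_k) : upper_posdiag U -> \det U = \prod_i U i i.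
Proof.
case=> U0 _; rewrite -det_tr det_trig; last first.
  by apply/is_trig_mxP => i j ij; rewrite mxE U0.
by apply: eq_bigr => i _; rewrite mxE.
Qed.

Lemma upper_posdiag_unitmx k (U : 'M[R]_k) : upper_posdiag U -> U \in unitmx.
Proof.
move=> Up; rewrite unitmxE unitfE det_upper_posdiag // gt_eqF //.
by apply: prodr_gt0 => i _; case: Up.
Qed.

Lemma mulmx_trE k m n (v : 'M[R]_(k, n)) (w : 'M[R]_(m, n)) i j :
  (v *m w^T) i j = \sum_l v i l * w j l.
Proof. by rewrite mxE; apply: eq_bigr => l _; rewrite mxE. Qed.

Lemma mulmx_tr_ge0 n (v : 'rV[R]_n) : 0 <= (v *m v^T) 0 0.
Proof. by rewrite mulmx_trE sumr_ge0 // => i _; rewrite -expr2 sqr_ge0. Qed.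

Lemma mulmx_tr_eq0 n (v : 'rV[R]_n) : (v *m v^T) 0 0 = 0 -> v = 0.
Proof.
rewrite mulmx_trE => /eqP; rewrite psumr_eq0 => [/allP h|i _]; last by rewrite -expr2 sqr_ge0.
apply/rowP => i; rewrite mxE; apply/eqP.
by have := h i (mem_index_enum _); rewrite mulf_eq0 orbb.
Qed.

Definition posdef k (G : 'M[R]_k) := forall v : 'rV_k, v != 0 -> 0 < (v *m G *m v^T) 0 0.

Lemma posdef_gram k n (E : 'M[R]_(k, n)) :
  (forall v : 'rV_k, v *m E = 0 -> v = 0) -> posdef (E *m E^T).
Proof.
move=> Einj v vN0; rewrite mulmxA -mulmxA -trmx_mul lt_neqAle mulmx_tr_ge0 andbT eq_sym.
by apply: contraNneq vN0 => /mulmx_tr_eq0/Einj ->.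
Qed.

(** With [U] upper triangular, the lower right block [C] of the product involves only the same block
    of [U], so the induction factors [C] first. The corner is the square root of the Schur
    complement of [C], which is the value of the form of [G] at [(1, -z)] with [z *m C = b]. *)
Lemma cholesky k (G : 'M[R]_k) : G^T = G -> posdef G ->
  exists2 U : 'M[R]_k, upper_posdiag U & G = U *m U^T.
Proof.
elim: k G => [|k IH] G Gs Gp.
  by exists 0; [split; case|apply/matrixP; case].
move: G Gs Gp; rewrite -[k.+1]/(1 + k)%N => G Gs Gp.
set a := ulsubmx G; set b := ursubmx G; set C := drsubmx G.
have bE : dlsubmx G = b^T by rewrite /b trmx_ursub Gs.
have GE : G = block_mx a b b^T C by rewrite -bE submxK.
have [||U Up CE] := IH C.
- by rewrite /C trmx_drsub Gs.
- move=> v vN0; have : row_mx 0 v != 0 :> 'rV_(1 + k).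
    by apply: contraNneq vN0; rewrite -row_mx0 => /eq_row_mx[_ ->].
  by move/Gp; rewrite GE mul_row_block !mul0mx !add0r tr_row_mx mul_row_col trmx0 mulmx0 add0r.
have Uu := upper_posdiag_unitmx Up.
have Utu : U^T \in unitmx by rewrite unitmx_tr.
pose v := b *m invmx U^T.
pose z := v *m invmx U.
have vU : v *m U^T = b by rewrite mulmxKV.
have zC : z *m C = b by rewrite CE mulmxA mulmxKV.
have zb : z *m b^T = v *m v^T by rewrite -vU trmx_mul trmxK mulmxA mulmxKV.
have pos : 0 < (a - v *m v^T) 0 0.
  have : row_mx 1%:M (- z) != 0 :> 'rV_(1 + k).
    apply/eqP; rewrite -row_mx0 => /eq_row_mx[/matrixP/(_ 0 0)] /eqP.
    by rewrite !mxE eqxx oner_eq0.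
  move/Gp; rewrite GE mul_row_block !mul1mx !mulNmx zC subrr zb.
  by rewrite tr_row_mx mul_row_col mul0mx addr0 trmx1 mulmx1.
pose u : 'M[R]_1 := (Num.sqrt ((a - v *m v^T) 0 0))%:M.
pose B : 'M[R]_(1 + k) := block_mx u v 0 U.
have BB : B *m B^T = G.
  rewrite tr_block_mx mulmx_block trmx0 !mul0mx !mulmx0 !add0r vU -CE.
  rewrite [RHS]GE; congr block_mx; last by rewrite -[in RHS]vU (trmx_mul v) trmxK.
  apply/matrixP => i j; rewrite !ord1 /u tr_scalar_mx -scalar_mxM -expr2 sqr_sqrtr ?ltW //.
  by rewrite !mxE eqxx mulr1n subrK.
exists B => //; case: Up => U0 Upd; split=> [i j|i].
  rewrite !mxE; case: splitP => i' ->; rewrite !mxE; case: splitP => j' -> //.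
  - by rewrite !ord1.
  - by rewrite ltnNge (leq_trans (ltnW (ltn_ord i'))) // leq_addr.
  - by rewrite mxE.
  - by rewrite ltn_add2l; exact: U0.
rewrite !mxE; case: splitP => i' ei; rewrite !mxE; case: splitP => j' ej.
- by rewrite !ord1 mxE eqxx mulr1n sqrtr_gt0.
- by have := ltn_ord i'; rewrite -ei ej.
- by have := ltn_ord j'; rewrite -ej ei.
- have -> : i' = j' by apply: ord_inj; apply/eqP; rewrite -(eqn_add2l 1) -ei ej.
  exact: Upd.
Qed.

(** * Weighted graphs with prescribed degrees and their Laplacians *)

Lemma interpolate (I : finType) (lo hi : I -> R) (t : R) :
  (forall i, lo i <= hi i) -> \sum_i lo i <= t <= \sum_i hi i ->
  exists2 a : I -> R, (forall i, lo i <= a i <= hi i) & \sum_i a i = t.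
Proof.
move=> lohi /andP[lt th].
set L := \sum_i lo i in lt *; set H := \sum_i hi i in th *.
have [HL|HL] := eqVneq H L.
  exists lo; first by move=> i; rewrite lexx lohi.
  by apply/eqP; rewrite -/L eq_le lt -HL th.
have LH : 0 < H - L by rewrite subr_gt0 lt_neqAle eq_sym HL (le_trans lt).
pose q := (t - L) / (H - L).
have q0 : 0 <= q by rewrite divr_ge0 ?subr_ge0 // ltW // -subr_gt0.
have q1 : q <= 1 by rewrite ler_pdivrMr // mul1r lerB.
exists (fun i => lo i + q * (hi i - lo i)).
  move=> i; have h : 0 <= hi i - lo i by rewrite subr_ge0.
  rewrite lerDl mulr_ge0 //= -lerBrDl.
  by rewrite ler_piMl.
by rewrite big_split /= -mulr_sumr sumrB -/L -/H /q divfK ?gt_eqF // addrC subrK.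
Qed.

Lemma weighted_degrees n (s : 'I_n -> R) :
  (forall i, 0 <= s i) -> (forall i, s i <= (\sum_j s j) / 2) ->
  exists w : 'I_n -> 'I_n -> R,
    [/\ forall i j, w i j = w j i, forall i j, 0 <= w i j, forall i, w i i = 0
      & forall i, \sum_j w i j = s i].
Proof.
elim: n s => [|n IH] s s0 sT; first by exists (fun _ _ => 0); split => // -[].
set T := \sum_j s j in sT; set m := s ord0; pose s' j := s (lift ord0 j).
have TE : T = m + \sum_j s' j by rewrite /T big_ord_recl.
(* Vertex [ord0] distributes its degree [m] over the others, so that the residual
   degrees satisfy the hypotheses again: vertex [j] must get at least [lo j]. *)
pose lo j := Num.max 0 (s' j + m - T / 2).
have [||a ab aE] := @interpolate _ lo s' m.
- by move=> i; rewrite ge_max s0 /= -addrA gerDl subr_le0 sT.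
- apply/andP; split; last first.
    by have := sT ord0; rewrite -/m; lra.
  rewrite (bigID (fun j => 0 < s' j + m - T / 2)) /= [X in _ + X]big1 ?addr0; last first.
    by move=> j; rewrite -leNgt => h; apply/max_idPl.
  rewrite (eq_bigr (fun j => s' j + (m - T / 2))); last first.
    by move=> j h; rewrite /lo addrA; apply/max_idPr/ltW.
  set J := [set j | 0 < s' j + m - T / 2]%SET.
  have mT : m - T / 2 <= 0 by rewrite subr_le0 sT.
  have -> : \sum_(j | 0 < s' j + m - T / 2) (s' j + (m - T / 2)) =
            \sum_(j in J) (s' j + (m - T / 2)) by apply: eq_bigl => j; rewrite inE.
  (* Two or more positive bounds add up to at most [(T - m) + 2 * (m - T / 2) = m], since
     [m - T / 2 <= 0]; a single one is at most [m] because [s' j <= T / 2]. *)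
  have [J2|J1] := leqP 2 #|J|.
    rewrite big_split /= sumr_const.
    have h1 : \sum_(j in J) s' j <= \sum_j s' j.
      by rewrite [leRHS](bigID (mem J)) /= lerDl sumr_ge0 // => j _; exact: s0.
    have h2 : (m - T / 2) *+ #|J| <= (m - T / 2) *+ 2.
      rewrite -[#|J|](subnK J2) mulrnDr gerDr.
      by rewrite mulrn_wle0.
    apply: le_trans (lerD h1 h2) _.
    by rewrite mulr2n; lra.
  have [->|[j jJ]] := set_0Vmem J; first by rewrite big_set0 s0.
  have -> : J = [set j]%SET.
    apply/setP => i; rewrite finset.in_set1; apply/idP/eqP => [iJ|-> //].
    exact: (card_le1_eqP J1).
  by rewrite big_set1; have := sT (lift ord0 j); rewrite -/(s' j); lra.
have [|i|w [ws w0 wd wE]] := IH (fun j => s' j - a j).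
- by move=> i; rewrite subr_ge0; case/andP: (ab i).
- rewrite sumrB aE; have /andP[h _] := ab i.
  have : s' i + m - T / 2 <= a i by apply: le_trans h; rewrite le_max lexx orbT.
  by lra.
exists (fun i j => match unlift ord0 i, unlift ord0 j with
  | None, None => 0 | None, Some j => a j | Some i, None => a i | Some i, Some j => w i j end).
have a0 i : 0 <= a i.
  by have /andP[h _] := ab i; apply: le_trans h; rewrite le_max lexx.
split.
- by move=> i j; case: unliftP => [i'|] _; case: unliftP => [j'|] _.
- by move=> i j; case: unliftP => [i'|] _; case: unliftP => [j'|] _.
- by move=> i; case: unliftP.
- move=> i; rewrite big_ord_recl unlift_none.
  under eq_bigr do rewrite liftK.
  case: unliftP => [i'|] ->; first by rewrite wE addrC subrK.
  by rewrite add0r aE.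
Qed.

Lemma finite_lower_bound (I : finType) (f : I -> R) :
  (forall i, 0 < f i) -> exists2 m, 0 < m & forall i, m <= f i.
Proof.
move=> f0; exists (\big[Num.min/1]_i f i); first exact: lt_bigmin.
by move=> i; exact: bigmin_le.
Qed.

Lemma laplacian_form (I : finType) (W : I -> I -> R) (f : I -> R) :
  (forall i j, W i j = W j i) ->
  \sum_i (\sum_j W i j) * f i ^+ 2 - \sum_i \sum_j W i j * f i * f j =
  2^-1 * \sum_i \sum_j W i j * (f i - f j) ^+ 2.
Proof.
move=> Ws.
have E1 : \sum_i (\sum_j W i j) * f i ^+ 2 = \sum_i \sum_j W i j * f i ^+ 2.
  by apply: eq_bigr => i _; rewrite mulr_suml.
have E2 : \sum_i \sum_j W i j * f i ^+ 2 = \sum_i \sum_j W i j * f j ^+ 2.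
  by rewrite exchange_big; apply: eq_bigr => i _; apply: eq_bigr => j _; rewrite Ws.
have -> : \sum_i \sum_j W i j * (f i - f j) ^+ 2 =
   \sum_i \sum_j W i j * f i ^+ 2 + \sum_i \sum_j W i j * f j ^+ 2
   - 2 * \sum_i \sum_j W i j * f i * f j.
  rewrite mulr_sumr -big_split -sumrB; apply: eq_bigr => i _ /=.
  rewrite mulr_sumr -big_split -sumrB; apply: eq_bigr => j _ /=.
  by ring.
by rewrite E1 -E2; field.
Qed.

(** Only the Laplacian without the row and column of [ord0] is factored, since it is positive
    definite; the vector at [ord0] is then forced to be minus the sum of the others. *)
Lemma facet_normals d (s : 'I_d.+1 -> R) :
  (forall i, 0 < s i) -> (forall i, s i < (\sum_j s j) / 2) ->
  exists N : 'M[R]_(d.+1, d), [/\ forall k, \sum_i N i k = 0,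
    forall i, (N *m N^T) i i = s i & row' ord0 N \in unitmx].
Proof.
move=> s0 sT; set T := \sum_j s j in sT.
have [m m0 ms] : exists2 m, 0 < m & forall i, m <= Num.min (s i) (T / 2 - s i).
  by apply: finite_lower_bound => i; rewrite lt_min s0 subr_gt0 sT.
(* [m] is the slack in the strict inequalities. Reserving weight [e] on every edge lowers each
   degree by [d * e], which this slack allows; adding [e] back in [W] makes all edge weights
   positive. *)
pose e := m / (d.+1%:R * d.+1%:R).
have S0 : 0 < d.+1%:R :> R by rewrite ltr0n.
have e0 : 0 < e by rewrite divr_gt0 // mulr_gt0.
have em : d.+1%:R * d.+1%:R * e = m by rewrite /e mulrC divfK // gt_eqF // mulr_gt0.
have S1 : 1 <= d.+1%:R :> R by rewrite ler1n.
have dS : d%:R = d.+1%:R - 1 :> R by rewrite -natr1 addrK.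
have [||w [ws w0 wd wE]] := @weighted_degrees _ (fun i => s i - d%:R * e).
- move=> i; have := ms i; rewrite le_min => /andP[h _].
  by rewrite subr_ge0; apply: le_trans h; rewrite -em dS; nra.
- move=> i; have := ms i; rewrite le_min => /andP[_ h].
  rewrite sumrB sumr_const card_ord -/T -[_ *+ _]mulr_natl dS; rewrite -em in h.
  by nra.
pose W i j := w i j + e * (i != j)%:R.
have WE i : \sum_j W i j = s i.
  rewrite big_split /= wE -mulr_sumr -natr_sum.
  have -> : (\sum_(j : 'I_d.+1) (i != j) = d)%N.
    transitivity (\sum_(j in predC1 i) 1)%N; last by rewrite sum1_card cardC1 card_ord.
    by rewrite [RHS]big_mkcond; apply: eq_bigr => j _; rewrite inE eq_sym; case: eqP.
  by rewrite mulrC subrK.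
have Ws i j : W i j = W j i by rewrite /W ws eq_sym.
have W0 i j : 0 <= W i j by rewrite addr_ge0 // mulr_ge0 // ltW.
pose L i j := (i == j)%:R * s i - W i j.
have Ld i : L i i = s i by rewrite /L /W wd eqxx mul1r /= mulr0 addr0 subr0.
have Ls i j : L i j = L j i.
  by rewrite /L Ws; have [->|ij] := eqVneq i j => //; rewrite !mul0r.
have LE i : \sum_j L i j = 0.
  rewrite sumrB WE (bigD1 i) //= eqxx mul1r big1 ?addr0 ?subrr // => j ji.
  by rewrite eq_sym (negPf ji) mul0r.
pose G := \matrix_(i, j) L (lift ord0 i) (lift ord0 j).
have Gs : G^T = G by apply/matrixP => i j; rewrite !mxE Ls.
have Gp : posdef G.
  move=> v vN0.
  (* Extending [v] by 0 at [ord0] turns the form of [G] at [v] into the Laplacian form at [f]. *)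
  pose f i := oapp (v 0) 0 (unlift ord0 i).
  have f00 : f ord0 = 0 by rewrite /f unlift_none.
  have fl j : f (lift ord0 j) = v 0 j by rewrite /f liftK.
  have -> : (v *m G *m v^T) 0 0 = \sum_i \sum_j L i j * f i * f j.
    rewrite big_ord_recl big1 ?add0r => [|j _]; last by rewrite f00 mulr0 mul0r.
    rewrite mulmx_trE exchange_big /=.
    rewrite big_ord_recl [X in _ = X + _]big1 ?add0r => [|j _]; last by rewrite f00 mulr0.
    apply: eq_bigr => j _; rewrite mxE mulr_suml; apply: eq_bigr => i _.
    by rewrite mxE !fl; ring.
  have -> : \sum_i \sum_j L i j * f i * f j =
    \sum_i (\sum_j W i j) * f i ^+ 2 - \sum_i \sum_j W i j * f i * f j.
    rewrite -sumrB; apply: eq_bigr => i _; rewrite WE.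
    under eq_bigr do rewrite !mulrBl; rewrite sumrB; congr (_ - _).
    rewrite (bigD1 i) //= eqxx mul1r big1 ?addr0 -?mulrA ?expr2 // => j ji.
    by rewrite eq_sym (negPf ji) !mul0r.
  rewrite laplacian_form // pmulr_rgt0 ?invr_gt0 //.
  have [i vi] : exists i, v 0 i != 0.
    by apply/existsP; apply: contraNT vN0; rewrite negb_exists => /forallP h;
      apply/eqP/rowP => i; rewrite mxE; apply/eqP; have := h i; rewrite negbK.
  (* One edge gives strict positivity: it joins [lift ord0 i], where [f] is nonzero, to [ord0],
     where [f] vanishes. *)
  rewrite (bigD1 (lift ord0 i)) //= ltr_pwDl //; last first.
    by rewrite sumr_ge0 // => j _; rewrite sumr_ge0 // => ? _; rewrite mulr_ge0 // sqr_ge0.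
  rewrite (bigD1 ord0) //= ltr_pwDl //; last first.
    by rewrite sumr_ge0 // => ? _; rewrite mulr_ge0 // sqr_ge0.
  rewrite mulr_gt0 //; first by rewrite /W /= ltr_wpDl // mulr1.
  by rewrite f00 fl subr0 lt_neqAle sqr_ge0 eq_sym sqrf_eq0 vi.
have [U Up GE] := cholesky Gs Gp.
exists (\matrix_(i, k) oapp (fun i' => U i' k) (- \sum_i' U i' k) (unlift ord0 i)).
have GUE i j : \sum_k U i k * U j k = L (lift ord0 i) (lift ord0 j).
  by rewrite -mulmx_trE -GE mxE.
split.
- move=> k; rewrite big_ord_recl mxE unlift_none /=.
  under [X in _ + X]eq_bigr do rewrite mxE liftK /=.
  by rewrite addNr.
- move=> i; rewrite mulmx_trE; under eq_bigr do rewrite mxE.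
  case: (unliftP ord0 i) => [i'|] ->; first by rewrite GUE Ld.
  under eq_bigr do rewrite /= mulrNN mulr_suml.
  rewrite exchange_big /=.
  under eq_bigr do under eq_bigr do rewrite mulr_sumr.
  under eq_bigr do rewrite exchange_big /=.
  under eq_bigr do under eq_bigr do rewrite GUE.
  have H j : \sum_(i < d) L (lift ord0 j) (lift ord0 i) = - L ord0 (lift ord0 j).
    by have := LE (lift ord0 j); rewrite big_ord_recl Ls => /eqP; rewrite addrC addr_eq0 => /eqP.
  under eq_bigr do rewrite H.
  have := LE ord0; rewrite big_ord_recl sumrN Ld => /eqP; rewrite addr_eq0 => /eqP.
  by [].
- have -> : row' ord0 (\matrix_(i, k) oapp (fun i' => U i' k) (- \sum_i' U i' k) (unlift ord0 i)) = U.
    by apply/matrixP => i k; rewrite !mxE liftK.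
  exact: upper_posdiag_unitmx.
Qed.

(** * Minors of Gram matrices *)

Lemma adj_gram_diag m n (X : 'M[R]_(m.+1, n)) i :
  (\adj (X *m X^T)) i i = \det (row' i X *m (row' i X)^T).
Proof.
rewrite mxE /cofactor addnn -mul2n exprM sqrrN expr1n expr1n mul1r; congr (\det _).
by apply/matrixP => j k; rewrite !mxE; apply: eq_bigr => l _; rewrite !mxE.
Qed.

(** Jacobi's identity: [X *m X^T] and [N *m N^T] are inverse up to the factor [c ^+ 2], so the
    adjugate of the first is a multiple of the second, and its diagonal entries are the Gram
    determinants of [row' i X]. *)
Lemma det_mulmx_tr_minor n (X N : 'M[R]_n.+1) c i : c != 0 -> X *m N^T = c%:M ->
  \det (row' i X *m (row' i X)^T) * \det (N *m N^T) = c ^+ (2 * n) * (N *m N^T) i i.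
Proof.
move=> c0 XN.
have NX : N^T *m X = c%:M.
  have : (c^-1 *: X) *m N^T = 1%:M by rewrite -scalemxAl XN scale_scalar_mx mulVf.
  move/mulmx1C; rewrite -scalemxAr => /(congr1 (fun A => c *: A)).
  by rewrite scalerA mulfV // scale1r scale_scalar_mx mulr1.
have XtN : X^T *m N = c%:M by rewrite -[N]trmxK -trmx_mul NX tr_scalar_mx.
set B := N *m N^T; pose A := X *m X^T.
have AB : A *m B = (c ^+ 2)%:M.
  by rewrite /A /B mulmxA -(mulmxA X) XtN mul_mx_scalar -scalemxAl XN scale_scalar_mx.
rewrite -adj_gram_diag -/A.
have /matrixP/(_ i i) : \adj A *m (A *m B) = \det A *: B.
  by rewrite mulmxA mul_adj_mx mul_scalar_mx.
rewrite AB mul_mx_scalar !mxE => adjE.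
have dAB : \det A * \det B = c ^+ 2 ^+ n.+1 by rewrite -det_mulmx AB det_scalar.
have c2 : c ^+ 2 != 0 by rewrite expf_neq0.
apply: (mulfI c2); rewrite mulrA adjE mulrAC dAB exprS -exprM -!mulrA.
by [].
Qed.

Section cofactors.
Variables (d : nat) (N : 'M[R]_(d.+1, d)).
Hypothesis N0 : forall k, \sum_i N i k = 0.
Hypothesis Nu : row' ord0 N \in unitmx.

(** The rows of [N] sum to 0, so subtracting [v 0 ord0] from every coefficient leaves [v *m N]
    unchanged and only the independent rows of [row' ord0 N] remain. *)
Lemma left_kernel_const (v : 'rV[R]_d.+1) : v *m N = 0 -> forall i j, v 0 i = v 0 j.
Proof.
move=> vN.
suff h i : v 0 i = v 0 ord0 by move=> i j; rewrite !h.
pose u : 'rV[R]_d := \row_j (v 0 (lift ord0 j) - v 0 ord0).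
have uN : u *m row' ord0 N = 0.
  apply/rowP => k; rewrite !mxE.
  have := congr1 (fun A : 'rV__ => A 0 k) vN; rewrite !mxE big_ord_recl.
  have := N0 k; rewrite big_ord_recl => /eqP; rewrite addr_eq0 => /eqP ->.
  rewrite mulrN mulr_sumr addrC -sumrB => h; apply: etrans h.
  by apply: eq_bigr => j _; rewrite !mxE mulrBl.
have {uN} u0 : u = 0 by rewrite -(mulmxK Nu u) uN mul0mx.
case: (unliftP ord0 i) => [j|] -> //.
by have /rowP/(_ j) := u0; rewrite !mxE => /eqP; rewrite subr_eq0 => /eqP.
Qed.

(** Whichever normal is omitted, the Gram determinant of the others is the same, so one scaling
    factor will serve all facets. *)
Lemma det_gram_row' l m :
  \det (row' l N *m (row' l N)^T) = \det (row' m N *m (row' m N)^T).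
Proof.
pose G := N *m N^T.
have onesG : const_mx 1 *m G = 0 :> 'rV_d.+1.
  rewrite /G mulmxA; have -> : const_mx 1 *m N = 0 :> 'rV_d.
    by apply/rowP => k; rewrite !mxE -[RHS](N0 k); apply: eq_bigr => i _; rewrite mxE mul1r.
  by rewrite mul0mx.
have G0 : \det G = 0.
  apply/eqP/det0P; exists (const_mx 1) => //.
  by apply/eqP => /rowP/(_ ord0) /eqP; rewrite !mxE oner_eq0.
(* [\adj G] is symmetric and its rows are in the left kernel of [N], so it is a
   constant matrix. *)
have rowc i j k : (\adj G) i j = (\adj G) i k.
  suff /left_kernel_const/(_ j k) : row i (\adj G) *m N = 0 by rewrite !mxE.
  (* The squared norm of [row i (\adj G) *m N] contains the product [\adj G *m G], which is [\det G]
     times the identity, hence 0. *)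
  apply: mulmx_tr_eq0; rewrite trmx_mul mulmxA -(mulmxA _ N) -/G.
  by rewrite -row_mul mul_adj_mx G0 raddf0 row0 mul0mx mxE.
have sym i j : (\adj G) i j = (\adj G) j i.
  by rewrite -[in RHS](_ : (\adj G)^T = \adj G) ?mxE // trmx_adj /G trmx_mul trmxK.
by rewrite -!adj_gram_diag -/G (rowc l l m) sym (rowc m l m).
Qed.

Lemma det_gram_row'_gt0 l : 0 < \det (row' l N *m (row' l N)^T).
Proof.
rewrite (det_gram_row' l ord0) det_mulmx det_tr -expr2 lt_neqAle sqr_ge0 andbT eq_sym.
by rewrite sqrf_eq0 -unitfE -unitmxE.
Qed.

End cofactors.

End linear_algebra.

(** * Convex hulls *)

Section convex_hull.
Context {R : realType}.

Lemma convexP n (A : set 'rV[R]_n) : @convex_set R 'rV[R]_n A <->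
  forall x y t, 0 <= t -> t <= 1 -> A x -> A y -> A (t *: x + (1 - t) *: y).
Proof.
split => [cA x y t t0 t1 Ax Ay|cA x y l].
  have := cA x y (Itv01 t0 t1); rewrite !inE; exact.
by rewrite !inE => Ax Ay; apply: cA.
Qed.

Lemma dotDr n (u x y : 'rV[R]_n) : dot u (x + y) = dot u x + dot u y.
Proof. by rewrite -big_split; apply: eq_bigr => i _; rewrite mxE mulrDr. Qed.

Lemma dotZr n a (u x : 'rV[R]_n) : dot u (a *: x) = a * dot u x.
Proof. by rewrite mulr_sumr; apply: eq_bigr => i _; rewrite mxE mulrCA. Qed.

Lemma dotC n (x y : 'rV[R]_n) : dot x y = dot y x.
Proof. by apply: eq_bigr => i _; rewrite mulrC. Qed.

Lemma dotDl n (u x y : 'rV[R]_n) : dot (x + y) u = dot x u + dot y u.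
Proof. by rewrite dotC dotDr !(dotC u). Qed.

Lemma dotZl n a (u x : 'rV[R]_n) : dot (a *: x) u = a * dot x u.
Proof. by rewrite dotC dotZr (dotC u). Qed.

Lemma dotNl n (u x : 'rV[R]_n) : dot (- x) u = - dot x u.
Proof. by rewrite -scaleN1r dotZl mulN1r. Qed.

Lemma dotNr n (u x : 'rV[R]_n) : dot u (- x) = - dot u x.
Proof. by rewrite dotC dotNl dotC. Qed.

Lemma conv_hull_dot_le n (A : set 'rV[R]_n) (y : 'rV[R]_n) (c : R) :
  (forall x, A x -> dot x y <= c) -> forall x, conv_hull A x -> dot x y <= c.
Proof.
move=> Ac x; apply: (smallest_sub (X := [set x | dot x y <= c])) => //.
apply/convexP => {}x z t t0 t1 /= xc zc.
rewrite dotDl !dotZl.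
apply: le_trans (_ : t * c + (1 - t) * c <= _); last by rewrite -mulrDl addrC subrK mul1r.
by apply: lerD; rewrite ler_wpM2l // subr_ge0.
Qed.

Lemma onesE n i : (ones : 'rV[R]_n) 0 i = 1.
Proof.
rewrite /ones summxE (bigD1 i) //= /std_basis mxE !eqxx big1 ?addr0 // => j ji.
by rewrite mxE /= eq_sym (negPf ji).
Qed.

Lemma dot_std_basis n i (y : 'rV[R]_n) : dot (std_basis i) y = y 0 i.
Proof.
rewrite /dot (bigD1 i) //= /std_basis mxE !eqxx big1 ?addr0 ?mul1r // => j ji.
by rewrite mxE /= (negPf ji) mul0r.
Qed.

Lemma dot_ones n (y : 'rV[R]_n) : dot ones y = \sum_i y 0 i.
Proof. by apply: eq_bigr => i _; rewrite onesE mul1r. Qed.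

Lemma sum_ones n : \sum_i (ones : 'rV[R]_n) 0 i = n%:R.
Proof. by under eq_bigr do rewrite onesE; rewrite sumr_const card_ord. Qed.

Lemma conv_comb_mem n (A : set 'rV[R]_n) : @convex_set R 'rV[R]_n A ->
  forall k (p : 'I_k -> 'rV[R]_n) (l : 'I_k -> R), (forall i, A (p i)) ->
  (forall i, 0 <= l i) -> \sum_i l i = 1 -> A (\sum_i l i *: p i).
Proof.
move=> /convexP cA; elim=> [|k IH] p l pA l0.
  by rewrite big_ord0 => /eqP; rewrite eq_sym oner_eq0.
rewrite big_ord_recl [in X in A X]big_ord_recl => l1.
set q := \sum_i l (lift ord0 i) in l1.
have q0 : 0 <= q by rewrite sumr_ge0.
have lq : l ord0 = 1 - q by rewrite -l1 addrK.
have [qE|qN] := eqVneq q 0.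
  rewrite lq qE subr0 scale1r big1 ?addr0 // => i _.
  move: qE => /eqP; rewrite psumr_eq0 // => /allP/(_ i (mem_index_enum _))/eqP ->.
  by rewrite scale0r.
have {}q0 : 0 < q by rewrite lt_neqAle eq_sym qN.
have -> : \sum_(i < k) l (lift ord0 i) *: p (lift ord0 i) =
   q *: (\sum_(i < k) (l (lift ord0 i) / q) *: p (lift ord0 i)).
  rewrite scaler_sumr; apply: eq_bigr => i _.
  by rewrite scalerA mulrCA divff ?mulr1.
rewrite lq addrC; apply: cA => //; first exact: ltW.
- by rewrite -subr_ge0 -lq.
- apply: IH => // [i|]; first by rewrite divr_ge0 // ltW.
  by rewrite -mulr_suml divff.
Qed.

End convex_hull.

(** * The polar of the polytope *)

Section polar.
Context {R : realType}.
Variable d : nat.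
Hypothesis hd : (2 <= d)%N.

Let D1 : 0 < d%:R - 1 :> R. Proof. by rewrite subr_gt0 ltr1n. Qed.

Local Notation ub := ((d%:R - 1) / (2 * d%:R + 2) : R).
Local Notation lb := (- d.+1%:R^-1 : R).

(** The polar of a hull is cut out by the generators: vertices of [Delta] give the upper bounds,
    those of its negative the lower bounds. The shift by [ones] is invisible on vectors with sum
    0. *)
Lemma polar_P_polytopeP (y : 'rV[R]_d.+1) : polar_sum0 (P_polytope R d) y <->
  \sum_i y 0 i = 0 /\ forall i, lb <= y 0 i <= ub.
Proof.
have dv i : dot (std_basis i - d.+1%:R^-1 *: ones) y = y 0 i - d.+1%:R^-1 * \sum_i y 0 i.
  by rewrite dotDl dotNl dotZl dot_std_basis dot_ones.
have E0 : 0 < 2 * d%:R + 2 :> R by rewrite ltr_wpDl.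
have S0 : 0 < d.+1%:R :> R by rewrite ltr0n.
split => -[y0 yb]; split => //.
  move: (y0); rewrite /sum0_space /= => sy0 i.
  have Di : Delta R d (std_basis i - d.+1%:R^-1 *: ones).
    by apply: sub_gen_smallest; exists i.
  apply/andP; split.
    have := yb (d.+1%:R *: - (std_basis i - d.+1%:R^-1 *: ones)).
    rewrite dotZl dotNl dv sy0 mulr0 subr0 => /(_ _)/wrap[].
      apply: sub_gen_smallest; right; exists (- (std_basis i - d.+1%:R^-1 *: ones)) => //.
      by exists (std_basis i - d.+1%:R^-1 *: ones).
    rewrite mulrN lerNl => h.
    by rewrite -(ler_pM2l S0) mulrN divff ?gt_eqF.
  have := yb (((2 * d%:R + 2) / (d%:R - 1)) *: (std_basis i - d.+1%:R^-1 *: ones)).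
  rewrite dotZl dv sy0 mulr0 subr0 => /(_ _)/wrap[].
    by apply: sub_gen_smallest; left; exists (std_basis i - d.+1%:R^-1 *: ones).
  by rewrite mulrAC ler_pdivrMr // mul1r ler_pdivlMr // mulrC.
apply: conv_hull_dot_le => _ [[x Dx <-]|[_ [x Dx <-] <-]].
  rewrite dotZl mulrC -ler_pdivlMr ?divr_gt0 // mul1r invf_div.
  apply: conv_hull_dot_le Dx => _ [i _ <-].
  by rewrite dv y0 mulr0 subr0; case/andP: (yb i).
rewrite dotZl dotNl -dotNr mulrC -ler_pdivlMr // mul1r.
apply: conv_hull_dot_le Dx => _ [i _ <-].
rewrite dotNr dv y0 mulr0 subr0 lerNl.
by case/andP: (yb i).
Qed.

(** The coordinate bounds hold strictly at 0, so the polar contains 0 and a small multiple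
    [(m / M) *: y] of any [y] with sum 0; the line through these two points contains [y]. *)
Lemma affine_hull_polar_P_polytope :
  affine_hull (polar_sum0 (P_polytope R d)) = sum0_space.
Proof.
have E0 : 0 < 2 * d%:R + 2 :> R by rewrite ltr_wpDl.
have ub0 : 0 < ub by rewrite divr_gt0.
have lb0 : lb < 0 by rewrite oppr_lt0 invr_gt0 ltr0n.
apply/seteqP; split.
  apply: smallest_sub => [x y t x0 y0|y []//].
  rewrite /sum0_space /=; under eq_bigr do rewrite !mxE.
  by rewrite big_split /= -!mulr_sumr x0 y0 !mulr0 addr0.
move=> y y0 A [affA PA].
pose M := 1 + \sum_i `|y 0 i|.
have M0 : 0 < M by rewrite ltr_pwDl // sumr_ge0.
pose m := Num.min ub (- lb).
have m0 : 0 < m by rewrite lt_min ub0 oppr_gt0.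
have yM i : `|y 0 i| <= M.
  by rewrite /M (bigD1 i) //= addrCA lerDl addr_ge0 // sumr_ge0.
have Pm : A ((m / M) *: y).
  apply/PA/polar_P_polytopeP; split.
    by under eq_bigr do rewrite mxE; rewrite -mulr_sumr y0 mulr0.
  move=> i; rewrite mxE.
  have : `|m / M * y 0 i| <= m.
    rewrite normrM (ger0_norm (ltW (divr_gt0 m0 M0))) mulrAC ler_pdivrMr //.
    by rewrite ler_wpM2l // ltW.
  rewrite ler_norml le_min => h.
  have {h} /andP[h1 /andP[h2 _]] := h.
  rewrite h2 andbT; apply: le_trans h1; rewrite lerNr.
  by rewrite ge_min lexx orbT.
have P0 : A 0.
  apply/PA/polar_P_polytopeP; split; first by rewrite big1 // => i _; rewrite mxE.
  by move=> i; rewrite mxE !ltW.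
have := affA _ _ (M / m) Pm P0; rewrite scaler0 addr0 scalerA.
by rewrite mulrA divfK ?gt_eqF // divff ?gt_eqF // scale1r.
Qed.

Lemma relint_polar_P_polytopeP (y : 'rV[R]_d.+1) :
  relint (polar_sum0 (P_polytope R d)) y <->
  \sum_i y 0 i = 0 /\ forall i, lb < y 0 i < ub.
Proof.
rewrite /relint /= affine_hull_polar_P_polytope; split.
  move=> [y0 /nbhs_ballP[e /= e0 yP]]; split=> // i.
  (* A change in coordinate [i] is compensated in coordinate [j] to stay in [sum0_space]; shifts by
     [e / 2] both ways then make the bounds strict. *)
  have [j ji] : exists j : 'I_d.+1, j != i.
    have [->|i0] := eqVneq i ord0; first by exists ord_max; rewrite -val_eqE /= -lt0n; case: d hd.
    by exists ord0; rewrite eq_sym.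
  have pert (s : R) : `|s| < e -> lb <= y 0 i + s <= ub.
    move=> se.
    have := yP (y + s *: (std_basis i - std_basis j)).
    case/(_ _ _)/wrap.
    - split => // k l; rewrite -ball_normE /ball_ /= !mxE ord1 eqxx /= opprD addrA subrr add0r normrN.
      rewrite normrM; apply: le_lt_trans se; rewrite ler_piMr //.
      by case: (l == i); case: (l == j); rewrite ?subrr ?subr0 ?sub0r ?normrN ?normr0 ?normr1.
    - rewrite /sum0_space /= -dot_ones dotDr dotZr dotDr dotNr !(dotC ones) !dot_std_basis.
      by rewrite !onesE subrr mulr0 addr0 dotC dot_ones.
    move/polar_P_polytopeP => [_ /(_ i)].
    by rewrite !mxE !eqxx /= [_ == j]eq_sym (negPf ji) subr0 mulr1.
  have /andP[h1 h2] : lb <= y 0 i + e / 2 <= ub by apply: pert; rewrite ger0_norm; lra.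
  have /andP[h3 h4] : lb <= y 0 i - e / 2 <= ub by apply: pert; rewrite normrN ger0_norm; lra.
  have e20 : 0 < e / 2 by rewrite divr_gt0.
  apply/andP; split; first by apply: le_lt_trans h3 _; rewrite gtrBl.
  by apply: lt_le_trans h2; rewrite ltrDl.
move=> [y0 yb]; split => //.
have : nbhs y [set z : 'rV[R]_d.+1 | forall i, lb < z 0 i < ub].
  apply: (@filter_forall _ _ (fun i (z : 'rV[R]_d.+1) => is_true (lb < z 0 i < ub)) (nbhs y)) => i.
  have : nbhs (y 0 i) [set` `]lb, ub[] by apply: near_in_itvoo; rewrite in_itv /= yb.
  move=> yi; suff : nbhs y ((fun z : 'rV[R]_d.+1 => z 0 i) @^-1` [set` `]lb, ub[]).
    rewrite /preimage /=; under eq_set do rewrite in_itv /=.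
    exact.
  exact: (@coord_continuous R 1 d.+1 0 i y _ yi).
apply: filterS => z zb z0; apply/polar_P_polytopeP; split => // i.
by have /andP[h1 h2] := zb i; rewrite !ltW.
Qed.

End polar.

(** * Volumes of simplices *)

Section volume.
Context {R : realType}.

Lemma lebesgue_tupleS k (S : set (k.+1.-tuple (measurableTypeR R))) :
  lebesgue_tuple S = (\int[lebesgue_measure]_x
    lebesgue_tuple [set t : k.-tuple (measurableTypeR R) | S [tuple of x :: t]])%E.
Proof.
rewrite /= /pushforward /product_measure1; apply: eq_integral => x _ /=.
congr lebesgue_tuple; apply/seteqP; split => t; rewrite /xsection /= inE //.
Qed.

Lemma lebesgue_tuple0 k : lebesgue_tuple (set0 : set (k.-tuple (measurableTypeR R))) = 0%E.
Proof.
elim: k => [|k IH]; first by rewrite /= dirac0.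
by rewrite lebesgue_tupleS /= IH integral0.
Qed.

Lemma lebesgue_tuple_ge0 k (S : set (k.-tuple (measurableTypeR R))) :
  (0 <= lebesgue_tuple S)%E.
Proof.
elim: k S => [|k IH] S; first by rewrite /= diracE lee_fin.
by rewrite lebesgue_tupleS integral_ge0.
Qed.

(* The library's [ge0_le_integral] assumes measurability, which [has_volume]
   does not require of its set. *)
Lemma ge0_le_integral_nomeas (f g : measurableTypeR R -> \bar R) :
  (forall x, 0 <= f x)%E -> (forall x, f x <= g x)%E ->
  (\int[lebesgue_measure]_x f x <= \int[lebesgue_measure]_x g x)%E.
Proof.
move=> f0 fg; have g0 x : (0 <= g x)%E by exact: le_trans (fg x).
rewrite !ge0_integralTE//; apply: le_ereal_sup => _ [h hf <-] /=.
by exists h => // x; exact: le_trans (fg x).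
Qed.

Lemma le_lebesgue_tuple k (A B : set (k.-tuple (measurableTypeR R))) :
  A `<=` B -> (lebesgue_tuple A <= lebesgue_tuple B)%E.
Proof.
elim: k A B => [|k IH] A B AB.
  rewrite /= !diracE lee_fin ler_nat; case: (boolP (_ \in A)) => //.
  by rewrite inE => /AB tB; rewrite mem_set.
rewrite !lebesgue_tupleS; apply: ge0_le_integral_nomeas => x.
  exact: lebesgue_tuple_ge0.
by apply: IH => t; exact: AB.
Qed.

(** The integrand will be the volume of a slice of a simplex. Its antiderivative is written as a
    polynomial [p], which yields continuity and derivability; for [r = 0] the interval is a
    point. *)
Lemma integral_affine_pow k (b r u c : R) : 0 <= r -> 0 < u ->
  (\int[lebesgue_measure]_(x in `[b, (b + r * u)%R]) ((r - (x - b) / u) ^+ k * c)%R%:E)%E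
   = (r ^+ k.+1 * (u * c) / k.+1%:R)%:E.
Proof.
move=> r0 u0; have [->|rN0] := eqVneq r 0.
  rewrite mul0r addr0 set_itv1 integral_set1 expr0n /= !mul0r //.
have {}r0 : 0 < r by rewrite lt_neqAle eq_sym rN0.
pose q : {poly R} := (r + b / u)%:P - u^-1 *: 'X.
have qE x : q.[x] = r - (x - b) / u by rewrite /q !hornerE; ring.
pose p := - (u * c / k.+1%:R) *: q ^+ k.+1.
have pE x : p.[x] = - (u * c / k.+1%:R) * (r - (x - b) / u) ^+ k.+1.
  by rewrite /p hornerZ horner_exp qE.
have dpE x : p^`().[x] = (r - (x - b) / u) ^+ k * c.
  rewrite /p derivZ deriv_exp hornerZ hornerMn hornerM horner_exp qE /q.
  rewrite derivB derivC derivZ derivX sub0r hornerN hornerZ hornerC /=.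
  rewrite -mulr_natr; field.
  by rewrite gt_eqF //= addrC natr1 pnatr_eq0.
transitivity ((p.[b + r * u])%:E - (p.[b])%:E)%E.
  apply: continuous_FTC2.
  - by rewrite ltrDl mulr_gt0.
  - apply: continuous_subspaceT; under eq_fun do rewrite -dpE.
    exact: continuous_horner.
  - split.
    + by move=> x _; exact: derivable_horner.
    + exact/cvg_at_right_filter/continuous_horner.
    + exact/cvg_at_left_filter/continuous_horner.
  - by move=> x _; rewrite -derivE dpE.
rewrite -EFinB !pE; congr EFin.
have -> : r - (b + r * u - b) / u = 0 by field; rewrite gt_eqF.
rewrite expr0n /= subrr mul0r subr0 mulr0 sub0r.
by field; rewrite addrC natr1 pnatr_eq0.
Qed.

(** For [r >= 0], the simplex with vertices [b] and [b + r *: row i U]; the slack in the sum is the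
    share of [b]. The size [r] is a parameter because slicing shrinks it. *)
Definition solid_simplex k n (b : 'rV[R]_n) (r : R) (U : 'M[R]_(k, n)) : set 'rV[R]_n :=
  [set b + y *m U | y in [set y : 'rV_k | (forall i, 0 <= y 0 i) /\ \sum_i y 0 i <= r]].

Lemma upper_posdiagS k (U : 'M[R]_k.+1) :
  upper_posdiag U -> upper_posdiag (\matrix_(i, j) U (lift ord0 i) (lift ord0 j)).
Proof.
by case=> U0 Up; split => [i j ji|i]; rewrite !mxE //; apply: U0; rewrite !lift0.
Qed.

Definition tuple_row k (t : k.-tuple (measurableTypeR R)) : 'rV[R]_k := \row_i tnth t i.

(** By triangularity the coordinate [x] alone determines the first coefficient [y]; fixing it shifts
    the base point and leaves size [r - y] for the other coefficients. *)
Lemma solid_simplex_slice k (b : 'rV[R]_k.+1) r (U : 'M[R]_k.+1) (x : R)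
    (t : k.-tuple (measurableTypeR R)) : upper_posdiag U ->
  let y := (x - b 0 ord0) / U ord0 ord0 in
  solid_simplex b r U (tuple_row [tuple of x :: t]) <->
  (0 <= y /\
   solid_simplex (\row_j (b 0 (lift ord0 j) + y * U ord0 (lift ord0 j))) (r - y)
     (\matrix_(i, j) U (lift ord0 i) (lift ord0 j)) (tuple_row t)).
Proof.
move=> [U0 Up] y; have u0 := Up ord0.
have yE : y * U ord0 ord0 = x - b 0 ord0 by rewrite /y divfK ?gt_eqF.
split.
  case=> z [z0 zr] /rowP zE.
  have z0E : z 0 ord0 = y.
    have := zE ord0; rewrite !mxE big_ord_recl big1 => [|i _]; last by rewrite U0 ?mulr0.
    rewrite addr0 tnth0 /y => <-; rewrite [b 0 _ + _]addrC addrK mulfK // gt_eqF //.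
  split; first by rewrite -z0E.
  exists (\row_i z 0 (lift ord0 i)); first split.
  - by move=> i; rewrite mxE.
  - rewrite lerBrDr; move: zr; rewrite big_ord_recl z0E addrC; apply: le_trans.
    by rewrite lerD2r; apply: ler_sum => i _; rewrite mxE.
  apply/rowP => j; have := zE (lift ord0 j); rewrite !mxE big_ord_recl z0E.
  rewrite tnthS addrA => <-; congr (_ + _).
  by apply: eq_bigr => i _; rewrite !mxE.
case=> y0 [z [z0 zr] /rowP zE].
exists (\row_i oapp (z 0) y (unlift ord0 i)); first split.
- by move=> i; rewrite mxE; case: unliftP => [j _|_] //=.
- rewrite big_ord_recl mxE unlift_none /= -lerBrDl; move: zr; apply: le_trans.
  by apply: ler_sum => i _; rewrite mxE liftK.
apply/rowP => j; rewrite !mxE big_ord_recl mxE unlift_none /=.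
case: (unliftP ord0 j) => [j' ->|->].
  have := zE j'; rewrite !mxE tnthS => <-; rewrite -!addrA; congr (_ + (_ + _)).
  by apply: eq_bigr => i _; rewrite !mxE liftK.
rewrite big1 => [|i _]; last by rewrite U0 ?mulr0.
by rewrite tnth0 yE addr0 addrC subrK.
Qed.

Lemma solid_simplex_lt0 k n (b : 'rV[R]_n) r (U : 'M[R]_(k, n)) :
  r < 0 -> solid_simplex b r U = set0.
Proof.
move=> r0; rewrite -subset0 => t [y [y0 yr] _].
by have := le_lt_trans yr r0; rewrite ltNge sumr_ge0.
Qed.

Lemma lebesgue_tuple_solid_simplex k (b : 'rV[R]_k) r (U : 'M[R]_k) :
  0 <= r -> upper_posdiag U ->
  lebesgue_tuple [set t | solid_simplex b r U (tuple_row t)] =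
  (r ^+ k * (\prod_i U i i) / k`!%:R)%:E.
Proof.
elim: k b r U => [|k IH] b r U r0 Up.
  rewrite /= diracE mem_set ?big_ord0 ?expr0 ?mulr1 ?divr1 //=.
  by exists 0; [split => [[]//|]; rewrite big_ord0|rewrite thinmx0; apply/rowP; case].
rewrite lebesgue_tupleS.
set b0 := b 0 ord0; set u := U ord0 ord0.
have u0 : 0 < u by exact: (proj2 Up).
pose U' := (\matrix_(i, j) U (lift ord0 i) (lift ord0 j)).
have Up' : upper_posdiag U' by exact: upper_posdiagS.
pose c := (\prod_i U' i i) / k`!%:R.
transitivity (\int[lebesgue_measure]_(x in `[b0, (b0 + r * u)%R])
  ((r - (x - b0) / u) ^+ k * c)%R%:E)%E; last first.
  rewrite integral_affine_pow //; congr EFin.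
  rewrite /c big_ord_recl factS natrM invfM !mulrA.
  under [in LHS]eq_bigr do rewrite mxE.
  by rewrite -/u; ring.
rewrite [RHS]integral_mkcond; apply: eq_integral => x _.
rewrite patchE; case: ifPn => [|]; rewrite ?notin_setE ?inE /= in_itv /=.
  move=> /andP[bx xb].
  have y0 : 0 <= (x - b0) / u by rewrite divr_ge0 ?subr_ge0 // ltW.
  have yr : 0 <= r - (x - b0) / u by rewrite subr_ge0 ler_pdivrMr // lerBlDl.
  rewrite mulrA -(IH (\row_j (b 0 (lift ord0 j) + (x - b0) / u * U ord0 (lift ord0 j))) _ U' yr Up').
  congr lebesgue_tuple; apply/seteqP; split => t /=.
    by case/(solid_simplex_slice _ _ _ _ Up).
  by move=> ?; apply/(solid_simplex_slice _ _ _ _ Up).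
(* Outside the interval either the first coefficient or the remaining size is negative, so the slice
   is empty. *)
move=> /negP; rewrite negb_and -!ltNge => xN.
rewrite -[RHS](lebesgue_tuple0 k); congr lebesgue_tuple.
apply/seteqP; split => t //= /(solid_simplex_slice _ _ _ _ Up) [].
rewrite -/b0 -/u pmulr_lge0 ?invr_gt0 // subr_ge0 => bx.
case/orP: xN; first by rewrite ltNge bx.
by move=> xb; rewrite solid_simplex_lt0 // subr_lt0 ltr_pdivlMr // ltrBrDl.
Qed.

Lemma solid_simplex_mul k n (U : 'M[R]_k) (Q : 'M[R]_(k, n)) (a : 'rV[R]_n) r t :
  Q *m Q^T = 1%:M ->
  solid_simplex a r (U *m Q) (a + t *m Q) <-> solid_simplex 0 r U t.
Proof.
move=> QQ; split => -[y yr yE]; exists y => //.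
  move/addrI : yE => /(congr1 (fun A => A *m Q^T)).
  by rewrite -!mulmxA QQ !mulmx1 add0r.
by rewrite -yE add0r mulmxA.
Qed.

(** The Cholesky factor [U] of the Gram matrix gives [E = U *m Q] with orthonormal rows in [Q]. In
    the coordinates of [Q] the edge matrix is the triangular [U], whose determinant is the square
    root of the Gram determinant. *)
Lemma has_volume_solid_simplex k n (a : 'rV[R]_n) (E : 'M[R]_(k, n)) :
  (forall v : 'rV_k, v *m E = 0 -> v = 0) ->
  has_volume k (solid_simplex a 1 E) (Num.sqrt (\det (E *m E^T)) / k`!%:R).
Proof.
move=> Einj.
have [U Up GE] : exists2 U : 'M[R]_k, upper_posdiag U & E *m E^T = U *m U^T.
  by apply: cholesky; [rewrite trmx_mul trmxK|exact: posdef_gram].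
have Uu := upper_posdiag_unitmx Up.
pose Q := invmx U *m E.
have QQ : Q *m Q^T = 1%:M.
  rewrite /Q trmx_mul mulmxA -(mulmxA _ E) GE mulmxA mulVmx // mul1mx.
  by rewrite -trmx_mul mulVmx // trmx1.
have EQ : E = U *m Q by rewrite /Q mulKVmx.
exists a, Q; split => //.
  by move=> _ [y _ <-]; exists (y *m U) => //=; rewrite -mulmxA -EQ.
rewrite GE det_mulmx det_tr -expr2 sqrtr_sqr det_upper_posdiag //.
rewrite ger0_norm; last by apply: prodr_ge0 => i _; rewrite ltW //; exact: (proj2 Up).
rewrite -[X in X / _](_ : 1 ^+ k * \prod_i U i i = _); last by rewrite expr1n mul1r.
rewrite -(lebesgue_tuple_solid_simplex 0 ler01 Up); congr lebesgue_tuple.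
apply/seteqP; split => t /=; rewrite [in X in solid_simplex a 1 X]EQ.
  by move/(solid_simplex_mul U a 1 (tuple_row t) QQ).
by move=> h; apply/(solid_simplex_mul U a 1 (tuple_row t) QQ).
Qed.

(** The coordinates behind [v] are arbitrary, so the edge matrix [M] in them need not be triangular.
    The volume is only bounded below, by that of a small simplex contained in the given one. *)
Lemma has_volume_solid_simplex_gt0 k n (a : 'rV[R]_n) (E : 'M[R]_(k, n)) v :
  (forall v : 'rV_k, v *m E = 0 -> v = 0) ->
  has_volume k (solid_simplex a 1 E) v -> 0 < v.
Proof.
move=> Einj [a' [Q [QQ sub vE]]].
pose y0 := (a - a') *m Q^T; pose M := E *m Q^T.
have proj x : solid_simplex a 1 E x -> x = a' + ((x - a') *m Q^T) *m Q.
  move=> /sub [t _ <-]; have -> : a' + t *m Q - a' = t *m Q by rewrite addrC addKr.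
  by rewrite -(mulmxA t) QQ mulmx1.
have aS : solid_simplex a 1 E a.
  exists 0; last by rewrite mul0mx addr0.
  by split; [move=> i; rewrite mxE|rewrite big1 // => i _; rewrite mxE].
have EM : E = M *m Q.
  apply/row_matrixP => i.
  have /proj : solid_simplex a 1 E (a + row i E).
    exists (delta_mx 0 i); last by rewrite -rowE.
    split; first by move=> j; rewrite mxE; case: (_ && _).
    rewrite (bigD1 i) //= big1 ?addr0 ?mxE ?eqxx // => j ji.
    by rewrite mxE /= (negPf ji).
  rewrite addrAC mulmxDl mulmxDl addrA -[a' + _](proj a) // => /addrI ->.
  by rewrite /M !row_mul.
have Mu : M \in unitmx.
  rewrite -row_free_unit -kermx_eq0; apply/eqP/row_matrixP => i; rewrite row0.
  by apply: Einj; rewrite EM mulmxA -row_mul mulmx_ker row0 mul0mx.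
pose K := \sum_i \sum_j `|invmx M i j|.
have K0 : 0 <= K by rewrite sumr_ge0 // => i _; rewrite sumr_ge0.
pose S : R := k.+1%:R.
have S1 : 1 <= S by rewrite ler1n.
have S0 : 0 < S by rewrite ltr0n.
(* Coefficients with respect to the rows of [M] then vary by at most [(S * S)^-1] around [S^-1]:
   they stay nonnegative, and their sum is at most [(S - 1) * (S + 1) / S ^+ 2 <= 1]. *)
pose r : R := (S * S * (K + 1))^-1.
have r0 : 0 < r by rewrite invr_gt0 !mulr_gt0 // ltr_wpDl.
have rK : r * K <= (S * S)^-1.
  have K1 : (K + 1)^-1 * K <= 1 by rewrite mulrC ler_pdivrMr ?ltr_wpDl // mul1r lerDl.
  by rewrite /r invfM -mulrA ler_piMr // invr_ge0 mulr_ge0 // ltW.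
(* A small simplex with orthonormal edges placed at the barycenter [b]. *)
pose b := y0 + const_mx S^-1 *m M.
have incl : [set t | solid_simplex b r (1%:M : 'M[R]_k) (tuple_row t)] `<=`
    [set t | solid_simplex a 1 E (a' + (\row_i tnth t i) *m Q)].
  move=> t [y [yp yr] yE]; rewrite /= -/(tuple_row t) -yE.
  have cb i : `|(y *m invmx M) 0 i| <= (S * S)^-1.
    apply: le_trans rK; rewrite mxE; apply: le_trans (ler_norm_sum _ _ _) _.
    rewrite /K mulr_sumr; apply: ler_sum => j _.
    rewrite normrM ger0_norm //; apply: ler_pM => //.
      by apply: le_trans yr; rewrite (bigD1 j) //= lerDl sumr_ge0.
    by rewrite (bigD1 i) //= lerDl sumr_ge0.
  exists (const_mx S^-1 + y *m invmx M).
    split=> [i|].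
      rewrite !mxE; have := cb i; rewrite ler_norml mxE => /andP[h _].
      apply: le_trans (_ : S^-1 - (S * S)^-1 <= _); last by rewrite lerD2l.
      by rewrite subr_ge0 lef_pV2 ?posrE ?mulr_gt0 // ler_peMr // ltW.
    apply: le_trans (_ : \sum_(i < k) (S^-1 + (S * S)^-1) <= _).
      apply: ler_sum => i _; rewrite mxE [X in X + _]mxE lerD2l.
      by apply: le_trans (cb i); exact: ler_norm.
    rewrite sumr_const card_ord -[_ *+ _]mulr_natl.
    have -> : k%:R = S - 1 by rewrite /S -natr1 addrK.
    rewrite -(ler_pM2r (mulr_gt0 S0 S0)) mul1r.
    have -> : (S - 1) * (S^-1 + (S * S)^-1) * (S * S) = (S - 1) * (S + 1).
      by field; rewrite gt_eqF.
    by nra.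
  have aE : a' + y0 *m Q = a by rewrite [RHS](proj a aS).
  have yE' : y *m Q = y *m invmx M *m E by rewrite [in RHS]EM mulmxA mulmxKV.
  by rewrite /b mulmx1 !mulmxDl -(mulmxA _ M) -EM yE' !addrA aE.
have := le_lebesgue_tuple incl; rewrite vE lebesgue_tuple_solid_simplex ?(ltW r0) //.
  rewrite lee_fin; apply: lt_le_trans; rewrite divr_gt0 ?ltr0n ?fact_gt0 //.
  by rewrite mulr_gt0 ?exprn_gt0 // prodr_gt0 // => i _; rewrite mxE eqxx.
split=> [i j ji|i]; rewrite mxE ?eqxx //.
by rewrite -val_eqE gtn_eqF.
Qed.

Lemma conv_hull_solid_simplex k n (a : 'rV[R]_n) (p : 'I_k -> 'rV[R]_n) :
  conv_hull (a |` range p) = solid_simplex a 1 (\matrix_i (p i - a)).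
Proof.
have mulE (y : 'rV_k) : y *m (\matrix_i (p i - a)) = \sum_i y 0 i *: (p i - a).
  by rewrite mulmx_sum_row; apply: eq_bigr => i _; rewrite rowK.
apply/seteqP; split.
  apply: smallest_sub.
    apply/convexP => x z t t0 t1 [y [y0 y1] <-] [w [w0 w1] <-].
    exists (t *: y + (1 - t) *: w).
      split=> [i|]; first by rewrite !mxE addr_ge0 // mulr_ge0 // subr_ge0.
      under eq_bigr do rewrite !mxE; rewrite big_split /= -!mulr_sumr.
      apply: le_trans (_ : t * 1 + (1 - t) * 1 <= _); last by rewrite !mulr1 addrC subrK.
      by apply: lerD; rewrite ler_wpM2l // subr_ge0.
    rewrite mulmxDl -!scalemxAl !scalerDr addrACA -scalerDl.
    by rewrite [t + _]addrC subrK scale1r.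
  move=> x [->|[i _ <-]].
    exists 0; last by rewrite mul0mx addr0.
    by split; [move=> i; rewrite mxE|rewrite big1 // => i _; rewrite mxE].
  exists (delta_mx 0 i); last by rewrite -rowE rowK addrC subrK.
  split; first by move=> j; rewrite mxE; case: (_ && _).
  rewrite (bigD1 i) //= big1 ?addr0 ?mxE ?eqxx // => j ji.
  by rewrite mxE /= (negPf ji).
move=> _ [y [y0 y1] <-] A [cA pA].
pose l (i : 'I_k.+1) := oapp (y 0) (1 - \sum_i y 0 i) (unlift ord0 i).
pose q (i : 'I_k.+1) := oapp p a (unlift ord0 i).
have -> : a + y *m (\matrix_i (p i - a)) = \sum_i l i *: q i.
  rewrite big_ord_recl /l /q unlift_none /= mulE scalerBl scale1r.
  rewrite [X in _ = _ + X](eq_bigr (fun i => y 0 i *: p i)) => [|i _]; last by rewrite liftK.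
  rewrite (eq_bigr (fun i => y 0 i *: p i - y 0 i *: a)) => [|i _]; last by rewrite scalerBr.
  by rewrite sumrB -scaler_suml addrAC addrA.
apply: (conv_comb_mem cA).
- by move=> i; apply: pA; rewrite /q; case: (unlift _ i) => [j|]; [right; exists j|left].
- by move=> i; rewrite /l; case: (unlift _ i) => [j|] //=; rewrite subr_ge0.
- rewrite big_ord_recl /l unlift_none /=; under [X in _ + X]eq_bigr do rewrite liftK /=.
  by rewrite subrK.
Qed.

End volume.

(** * Simplices with prescribed facet volumes *)

Section facet_volumes.
Context {R : realType}.

(** Every vertex [x l] of a facet can serve as its base point; the proofs below pick a convenient
    [l] different from the index of the facet. *)
Lemma facet_lift d (x : 'I_d.+2 -> 'rV[R]_d.+1) (l : 'I_d.+2) (i : 'I_d.+1) :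
  facet x (lift l i) = solid_simplex (x l) 1 (\matrix_j (x (lift l (lift i j)) - x l)).
Proof.
rewrite -(conv_hull_solid_simplex (x l) (fun j : 'I_d => x (lift l (lift i j)))).
congr conv_hull; apply/seteqP; split.
  move=> _ [j /= ji <-]; case: (unliftP l j) ji => [j' ->|-> _]; last by left.
  rewrite (inj_eq lift_inj); case: (unliftP i j') => [q -> _|->]; last by rewrite eqxx.
  by right; exists q.
move=> _ [->|[j _ <-]] /=; first by exists l => //=; exact: neq_lift.
by exists (lift l (lift i j)) => //=; rewrite (inj_eq lift_inj) eq_sym neq_lift.
Qed.

Lemma affinely_independent_edges d (x : 'I_d.+2 -> 'rV[R]_d.+1) (l : 'I_d.+2)
    (i : 'I_d.+1) (v : 'rV_d) :
  affinely_independent x -> v *m (\matrix_j (x (lift l (lift i j)) - x l)) = 0 -> v = 0.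
Proof.
move=> xi vE.
(* An edge relation becomes an affine one: coefficient 0 at the vertex opposite the facet, and minus
   the sum of [v] at the base point [x l]. *)
pose c q : R := if unlift l q is Some q' then oapp (v 0) 0 (unlift i q') else - \sum_j v 0 j.
have cl : c l = - \sum_j v 0 j by rewrite /c unlift_none.
have ci : c (lift l i) = 0 by rewrite /c liftK unlift_none.
have cj j : c (lift l (lift i j)) = v 0 j by rewrite /c !liftK.
apply/rowP => j; rewrite mxE -cj; apply: xi.
  rewrite (bigD1_ord l) //= (bigD1_ord i) //= cl ci add0r.
  by under [X in _ + X]eq_bigr do rewrite cj; rewrite addNr.
rewrite (bigD1_ord l) //= (bigD1_ord i) //= cl ci scale0r add0r.
under [X in _ + X]eq_bigr do rewrite cj.
rewrite -[RHS]vE mulmx_sum_row; under [in RHS]eq_bigr do rewrite rowK scalerBr.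
by rewrite sumrB scaleNr scaler_suml addrC.
Qed.

Lemma nth_root_exists n (y : R) : (0 < n)%N -> 0 < y -> exists2 c, 0 < c & c ^+ n = y.
Proof.
move=> n0 y0; exists (y `^ n%:R^-1); first exact: powR_gt0.
by rewrite -powR_mulrn ?powR_ge0 // -powRrM mulVf ?powRr1 ?ltW // pnatr_eq0 -lt0n.
Qed.

Lemma ord_neq_exists n (i : 'I_n.+2) : exists l, l != i.
Proof.
by have [->|i0] := eqVneq i ord0; [exists ord_max|exists ord0; rewrite eq_sym].
Qed.

Lemma simplex_with_facet_volumes k (s : 'I_k.+2 -> R) : (0 < k)%N ->
  (forall i, 0 < s i) -> (forall i, s i < (\sum_j s j) / 2) ->
  exists x : 'I_k.+2 -> 'rV[R]_k.+1, affinely_independent x /\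
    forall i, has_volume k (facet x i) (Num.sqrt (s i)).
Proof.
move=> k0 s0 sT.
have [N [N0 Ns Nu]] := facet_normals s0 sT.
pose del := \det (row' ord0 N *m (row' ord0 N)^T).
have del0 : 0 < del := det_gram_row'_gt0 N0 Nu ord0.
have f0 : 0 < k`!%:R :> R by rewrite ltr0n fact_gt0.
have [c c0 cE] : exists2 c, 0 < c & c ^+ (2 * k) = del * k`!%:R ^+ 2.
  by apply: nth_root_exists; rewrite ?muln_gt0 // mulr_gt0 // exprn_gt0.
have cN0 : c != 0 by rewrite gt_eqF.
pose X0 : 'M[R]_k.+1 := c *: invmx (row' ord0 N)^T.
have X0N : X0 *m (row' ord0 N)^T = c%:M.
  by rewrite /X0 -scalemxAl mulVmx ?unitmx_tr // scale_scalar_mx mulr1.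
pose x (i : 'I_k.+2) : 'rV[R]_k.+1 := oapp (fun j => row j X0) 0 (unlift ord0 i).
have xl j i : (x (lift ord0 j) *m N^T) 0 (lift ord0 i) = c * (j == i)%:R.
  rewrite /x liftK /= -row_mul mxE.
  have /matrixP/(_ j i) := X0N; rewrite !mxE mulr_natr => <-.
  by apply: eq_bigr => q _; rewrite !mxE.
(* All vertices except [x i] have the same product with normal [i], so this normal is orthogonal to
   the facet opposite [x i]. *)
have xN j i : (x j *m N^T) 0 i = c * ((j == i)%:R - (ord0 == i)%:R).
  case: (unliftP ord0 j) => [j'|] ->; last first.
    by rewrite /x unlift_none /= mul0mx mxE subrr mulr0.
  case: (unliftP ord0 i) => [i'|] ->.
    by rewrite xl (inj_eq lift_inj) subr0.
  rewrite eqxx sub0r mulrN1.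
  have : \sum_i (x (lift ord0 j') *m N^T) 0 i = 0.
    under eq_bigr do rewrite mulmx_trE; rewrite exchange_big big1 // => q _.
    by rewrite -mulr_sumr N0 mulr0.
  rewrite big_ord_recl; under [X in _ + X]eq_bigr do rewrite xl.
  rewrite -mulr_sumr (bigD1 j') //= eqxx big1 ?addr0 ?mulr1 => [|q qj].
    by move/eqP; rewrite addr_eq0 => /eqP.
  by rewrite eq_sym (negPf qj).
have xi : affinely_independent x.
  move=> a a0 ax i.
  have := congr1 (fun v : 'rV__ => (v *m N^T) 0 i) ax.
  rewrite /= mul0mx [RHS]mxE mulmx_suml summxE.
  under eq_bigr do rewrite -scalemxAl mxE xN mulrCA.
  rewrite -mulr_sumr; under eq_bigr do rewrite mulrBr.
  rewrite sumrB -mulr_suml a0 mul0r subr0 (bigD1 i) //= eqxx mulr1 big1 ?addr0 => [|j ji].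
    by move/eqP; rewrite mulf_eq0 (negPf cN0) => /eqP.
  by rewrite (negPf ji) mulr0.
exists x; split=> // i.
have [l li] := ord_neq_exists i.
case: (unliftP l i) li => [i'|] ->; last by rewrite eqxx.
move=> _; rewrite facet_lift.
pose X : 'M[R]_k.+1 := \matrix_j (x (lift l j) - x l).
set E := \matrix_j _.
have EX : E = row' i' X by apply/matrixP => j q; rewrite !mxE.
(* The terms of [xN] that single out [ord0] cancel in differences, so the duality holds with any [l]
   as base vertex. *)
have XN : X *m (row' l N)^T = c%:M.
  apply/matrixP => j q.
  have -> : (X *m (row' l N)^T) j q = ((x (lift l j) - x l) *m N^T) 0 (lift l q).
    by rewrite !mulmx_trE; apply: eq_bigr => p _; rewrite !mxE.
  rewrite mulmxBl [LHS]mxE [X in _ + X]mxE !xN (inj_eq lift_inj) [l == _](negPf (neq_lift _ _)).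
  by rewrite [RHS]mxE -[RHS]mulr_natr /= mulr0n; ring.
have := det_mulmx_tr_minor i' cN0 XN.
rewrite (det_gram_row' N0 Nu l ord0) -/del -EX cE.
have -> : (row' l N *m (row' l N)^T) i' i' = s (lift l i').
  by rewrite -Ns !mulmx_trE; apply: eq_bigr => p _; rewrite !mxE.
rewrite [LHS]mulrC -[RHS]mulrA => /(mulfI (lt0r_neq0 del0)) dE.
have -> : Num.sqrt (s (lift l i')) = Num.sqrt (\det (E *m E^T)) / k`!%:R.
  rewrite dE sqrtrM ?sqr_ge0 // sqrtr_sqr ger0_norm ?ltW // mulrAC divff ?mul1r //.
apply: has_volume_solid_simplex => v; exact: affinely_independent_edges.
Qed.

Lemma acute_squared_volumesP k (s : 'rV[R]_k.+2) : (0 < k)%N ->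
  acute_squared_volumes R k.+1 s <->
  (forall i, 0 < s 0 i) /\ (forall i, s 0 i < (\sum_j s 0 j) / 2).
Proof.
move=> k0.
have half (t : 'I_k.+2 -> R) i : (t i < \sum_(j | j != i) t j) = (t i < (\sum_j t j) / 2).
  by rewrite [in RHS](bigD1 i) //=; apply/idP/idP; lra.
split=> [[alpha [[x [xi xv]] ac] <-]|[s0 sT]].
  split=> i; last first.
    under eq_bigr do rewrite mxE.
    by rewrite mxE -(half (fun j => alpha 0 j ^+ 2)); exact: ac.
  rewrite mxE exprn_gt0 //.
  have [l li] := ord_neq_exists i.
  have := xv i; case: (unliftP l i) li => [i'|] ->; last by rewrite eqxx.
  move=> _; rewrite facet_lift; apply: has_volume_solid_simplex_gt0 => v.
  exact: affinely_independent_edges.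
have [x [xi xv]] := simplex_with_facet_volumes k0 s0 sT.
have sq i : Num.sqrt (s 0 i) ^+ 2 = s 0 i by rewrite sqr_sqrtr // ltW.
exists (\row_i Num.sqrt (s 0 i)); last by apply/rowP => i; rewrite !mxE sq.
split; first by exists x; split=> // i; rewrite mxE; exact: xv.
move=> i; rewrite !mxE sq; under eq_bigr do rewrite mxE sq.
by rewrite half.
Qed.

End facet_volumes.

Theorem corollary1p3 (R : realType) (d : nat) (hd : (2 <= d)%N) :
  acute_squared_volumes R d `&` sum1_plane =
  [set y + (d.+1%:R)^-1 *: ones | y in relint (polar_sum0 (P_polytope R d))].
Proof.
have S0 : d.+1%:R != 0 :> R by rewrite pnatr_eq0.
(* Translation by [d.+1%:R^-1 *: ones] thus carries the bounds of the polar to 0 and [2^-1]. *)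
have ubE : (d%:R - 1) / (2 * d%:R + 2) = 2^-1 - d.+1%:R^-1 :> R.
  have -> : d%:R = d.+1%:R - 1 :> R by rewrite -natr1 addrK.
  by move: S0; set D := d.+1%:R => S0; rewrite mulrBr mulr1 subrK; field.
have step1 (s : 'rV[R]_d.+1) : (acute_squared_volumes R d `&` sum1_plane) s <->
    \sum_i s 0 i = 1 /\ forall i, 0 < s 0 i < 2^-1.
  (* Once the total is 1, the half-sum bound of [acute_squared_volumesP] reads [s 0 i < 2^-1]. *)
  case: d hd s {S0 ubE} => // k hk s; rewrite /setI /= /sum1_plane /= acute_squared_volumesP //.
  split=> [[[h1 h2] h3]|[h3 h]]; split=> //.
    by move=> i; rewrite h1; have := h2 i; rewrite h3 mul1r.
  by split=> i; have /andP[] := h i; rewrite ?h3 ?mul1r.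
apply/seteqP; split=> [s /step1[s1 sb]|_ [y /(relint_polar_P_polytopeP hd)[y0 yb] <-]].
  exists (s - d.+1%:R^-1 *: ones); last by rewrite subrK.
  apply/(relint_polar_P_polytopeP hd); split.
    under eq_bigr do rewrite !mxE; rewrite sumrB s1 -mulr_sumr sum_ones mulVf //.
    by rewrite subrr.
  move=> i; rewrite !mxE onesE mulr1 ubE.
  by rewrite -[X in X < _]add0r !ltrD2r sb.
apply/step1; split.
  under eq_bigr do rewrite !mxE; rewrite big_split /= y0 -mulr_sumr sum_ones mulVf //.
  by rewrite add0r.
move=> i; rewrite !mxE onesE mulr1.
by have := yb i; rewrite ubE ltrBrDr -[X in X < _]sub0r ltrBlDr.
Qed.
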